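(* Let $\varepsilon>0$ and let $T(V,E,w)$ be a weighted rooted tree such that for every $v\in V$, $$w(v)\le \inf_{u\in V_v}w(u)+\varepsilon,$$ where $V_v$ is the set consisting of $v$ and all descendants of $v$. Then there exists a weight function $\widehat w:V\to\mathbb{R}_+$ such that $T(V,E,\widehat w)$ is a type-$2$ convex tree and $\|w-\widehat w\|_\infty\le \varepsilon/2$.
   Context: All trees are finite. $\mathbb{R}_+=[0,\infty)$. A weighted rooted tree $T(V,E,w)$ is a rooted tree with vertex set $V$, edge set $E$ and a weight function $w:V\to\mathbb{R}_+$. It is type-$2$ convex if for every internal vertex $v$ having at least two children, and every two distinct children $v_1,v_2$ of $v$, $2w(v)\le w(v_1)+w(v_2)$. $\|f\|_\infty=\sup_{v\in V}|f(v)|$. *)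

(* Defs.v *)
From mathcomp Require Import all_boot all_order all_algebra.
From mathcomp Require Import all_classical all_reals.
Set Implicit Arguments.
Unset Strict Implicit.
Unset Printing Implicit Defensive.
Import Order.TTheory GRing.Theory Num.Theory.
Local Open Scope classical_set_scope.
Local Open Scope ring_scope.

(* The bound in tree_acyclic is 2 because [:: x; y] is already a ucycle of the
   edge relation whenever xy is an edge; cycles of a simple graph have length
   at least 3. *)
Record rooted_tree (V : finType) := RootedTree {
  tree_edge : rel V;
  tree_root : V;
  tree_edge_sym : symmetric tree_edge;
  tree_edge_irrefl : irreflexive tree_edge;
  tree_connected : forall x y : V, connect tree_edge x y;
  tree_acyclic : forall c : seq V, ucycle tree_edge c -> (size c <= 2)%N
}.

Section RootedTrees.
Variables (V : finType) (T : rooted_tree V).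

(* root :: p is the (unique) simple path from the root to u. *)
Definition root_path (u : V) (p : seq V) : Prop :=
  [/\ path (tree_edge T) (tree_root T) p, last (tree_root T) p = u
    & uniq (tree_root T :: p)].

(* V_v: the vertices u such that v lies on the path from the root to u;
   v itself is included. *)
Definition subtree (v : V) : set V :=
  [set u | exists2 p, root_path u p & v \in tree_root T :: p].

Definition children (v : V) : set V :=
  [set u | tree_edge T v u /\ subtree v u].

(* The existence of two distinct children makes v internal with at least two
   children. *)
Definition type2_convex (R : realType) (w : V -> R) : Prop :=
  forall v v1 v2 : V, children v v1 -> children v v2 -> v1 <> v2 ->
    2 * w v <= w v1 + w v2.

End RootedTrees.

Definition weight_function (V : finType) (R : realType) (w : V -> R) : Prop :=
  forall v, 0 <= w v.

Definition sup_norm (V : finType) (R : realType) (f : V -> R) : R :=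
  sup [set `|f v| | v in [set: V]].

(* Main.v *)
Require Import Defs.
From mathcomp Require Import all_boot all_order all_algebra.
From mathcomp Require Import all_classical all_reals.
From mathcomp Require Import lra.
Set Implicit Arguments.
Unset Strict Implicit.
Unset Printing Implicit Defensive.
Import Order.TTheory GRing.Theory Num.Theory.
Local Open Scope classical_set_scope.
Local Open Scope ring_scope.

(** The weight [w' v := inf_(u in V_v) w u + eps / 2] works. The hypothesis on
    [w], together with [inf_(V_v) w <= w v], says that [w v] lies in the
    interval of length [eps] starting at [inf_(V_v) w]; its midpoint [w' v] is
    then at distance at most [eps / 2] from [w v]. If [c] is a child of [v]
    then [V_c] is contained in [V_v], so that [w' v <= w' c]; adding this
    inequality for two children gives type-2 convexity.

    The inclusion [V_c `<=` V_v] is where the tree structure matters.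
    Membership in a subtree asks for some simple path from the root through a
    given vertex; the inclusion needs that all simple paths from the root to
    [c] coincide ([acyclic_simple_path_unique]), so that [v] lies on the
    initial part of every simple path through [c] ([subtree_sub]). *)

(** If two simple paths with the same ends leave [x] through different
    neighbours [a] and [b], going along the first and back along the second
    joins [a] to [b] without meeting [x]; a simple path extracted from this walk
    closes up through [x] into a cycle of length at least 3. *)
Lemma acyclic_simple_path_unique (V : eqType) (e : rel V) :
    symmetric e -> (forall c, ucycle e c -> (size c <= 2)%N) ->
  forall (x : V) (p q : seq V),
    path e x p -> path e x q -> uniq (x :: p) -> uniq (x :: q) ->
    last x p = last x q -> p = q.
Proof.
move=> e_sym e_acyclic x p; elim: p x => [|a p IHp] x [|b q] //=.
- by move=> _ _ _ /andP[xNq _] xE; rewrite xE mem_last in xNq.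
- by move=> _ _ /andP[xNp _] _ xE; rewrite -xE mem_last in xNp.
move=> /andP[xa ap] /andP[xb bq] /andP[xNp Up] /andP[xNq Uq] lastE.
have [ab|aNb] := eqVneq a b.
  by rewrite -ab in bq Uq lastE *; rewrite (IHp a q).
pose r := p ++ rev (belast b q).
have ar : path e a r.
  rewrite cat_path ap lastE rev_path.
  by rewrite (@eq_path _ _ e) // => y z; rewrite e_sym.
have rE : last a r = b.
  rewrite last_cat; case: (q) lastE => [|c s] //= _.
  by rewrite rev_cons last_rcons.
have xNr : x \notin a :: r.
  rewrite -cat_cons mem_cat mem_rev negb_or xNp /=.
  by apply: contra xNq; apply: mem_belast.
case/shortenP: ar rE => s as_ Us s_sub sE.
have xNs : x \notin a :: s.
  move: xNr; rewrite !inE !negb_or => /andP[-> /=].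
  by apply: contra; apply: s_sub.
have /e_acyclic : ucycle e [:: x, a & s].
  apply/andP; split; last by rewrite cons_uniq xNs Us.
  by rewrite /= rcons_path xa as_ sE e_sym xb.
by case: s sE {as_ Us s_sub xNs} => // abE; rewrite -abE eqxx in aNb.
Qed.

Lemma exists_root_path (V : finType) (T : rooted_tree V) (u : V) :
  exists p, root_path T u p.
Proof.
have /connectP[p rp ->] := tree_connected T (tree_root T) u.
by case/shortenP: rp => q rq Uq _; exists q.
Qed.

Lemma mem_subtree (V : finType) (T : rooted_tree V) (v : V) : subtree T v v.
Proof.
have [p pv] := exists_root_path T v; exists p => //.
by case: pv => _ <- _; apply: mem_last.
Qed.

Lemma subtree_sub (V : finType) (T : rooted_tree V) (v c : V) :
  subtree T v c -> subtree T c `<=` subtree T v.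
Proof.
move=> [p [rp pc Up] v_p] u [q q_u c_q]; exists q => //.
case: q_u c_q => rq _ Uq c_q; move: rq Uq.
case/splitPl: c_q => q1 q2 q1c.
rewrite cat_path -cat_cons cat_uniq mem_cat => /andP[rq1 _] /andP[Uq1 _].
(* the part of the path up to c is the given path p through v *)
have <- : p = q1.
  by apply: (acyclic_simple_path_unique (@tree_edge_sym _ T)
    (@tree_acyclic _ T) rp rq1 Up Uq1); rewrite pc.
by rewrite v_p.
Qed.

Section SubtreeInf.
Variables (R : realType) (V : finType) (T : rooted_tree V) (w : V -> R).
Hypothesis w_ge0 : weight_function w.

Definition subtree_inf (v : V) : R := inf [set w u | u in subtree T v].

Lemma subtree_inf_le (v u : V) : subtree T v u -> subtree_inf v <= w u.
Proof.
by move=> vu; apply: ge_inf; [exists 0 => _ [z _ <-] | exists u].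
Qed.

Lemma le_subtree_inf (v : V) (a : R) :
  (forall u, subtree T v u -> a <= w u) -> a <= subtree_inf v.
Proof.
move=> aw; apply: lb_le_inf => [|_ [u vu <-]]; last exact: aw.
by exists (w v), v => //; apply: mem_subtree.
Qed.

Lemma subtree_inf_descendant (v c : V) :
  subtree T v c -> subtree_inf v <= subtree_inf c.
Proof.
by move=> /subtree_sub sub; apply: le_subtree_inf => u /sub /subtree_inf_le.
Qed.

End SubtreeInf.

Theorem theorem2p3 (R : realType) (eps : R) (eps_gt0 : 0 < eps)
    (V : finType) (T : rooted_tree V) (w : V -> R)
    (w_weight : weight_function w)
    (w_inf : forall v : V, w v <= inf [set w u | u in subtree T v] + eps) :
  exists w' : V -> R,
    [/\ weight_function w',
        type2_convex T w'
      & sup_norm (fun v => w v - w' v) <= eps / 2].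
Proof.
exists (fun v => subtree_inf T w v + eps / 2); split.
- move=> v; apply: addr_ge0; last by rewrite divr_ge0 // ltW.
  by apply: le_subtree_inf.
- move=> v v1 v2 [_ /(subtree_inf_descendant w_weight) le1].
  by move=> [_ /(subtree_inf_descendant w_weight) le2] _; lra.
- (* the root makes V nonempty, so that sup is a least upper bound *)
  apply: ge_sup; first by eexists; exists (tree_root T).
  move=> _ [v _ <-]; rewrite ler_norml.
  have := w_inf v; rewrite -/(subtree_inf T w v) => le_inf.
  have := subtree_inf_le w_weight (mem_subtree T v) => inf_le.
  by apply/andP; split; lra.
Qed.
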